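(* Let $p$ be an odd prime, let $e$ be a positive integer, and assume that either $p\equiv 1\pmod 4$ (with any $e$), or $p\equiv 3\pmod 4$ and $e$ is even. Let $q=p^e$ and $s=\frac{p(q^2-1)}{2}$. Let $b_k$ ($1\le k\le s-q+2$) be the coefficients defined in the context. Then the following identities hold in $\mathbb{F}_q$: \[ \sum_{x\in\mathbb{F}_q} f_j(x)= \begin{cases} 0 & \text{if } 1\le j\le q-1,\\ -b_{j-(q-1)} & \text{if } q\le j\le q+1,\\ -b_{j-(q-1)}-\displaystyle\sum_{x\in\mathbb{F}_q} f_{j-(q+1)}(x) & \text{if } q+2\le j\le s-(q+1),\\ -b_{j+2} & \text{if } j=s-q,\\ 0 & \text{if } s-(q-1)\le j\le s. \end{cases} \]
   Context: The $n$-th Fibonacci polynomial $f_n$ is defined by $f_0(x)=0$, $f_1(x)=1$, and $f_n(x)=xf_{n-1}(x)+f_{n-2}(x)$ for $n\ge 2$; these polynomials are evaluated at elements of the finite field $\mathbb{F}_q$ with $q$ elements. The coefficients $b_k$ are defined by the identity $\sum_{k=1}^{s-q+2} b_k z^k=\dfrac{z^{s+1}-z}{z^{q-1}-1}$; explicitly, $b_k=1$ if $k=1+t(q-1)$ for some integer $t$ with $0\le t\le \frac{p(q+1)}{2}-1$, and $b_k=0$ otherwise. *)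

(* Defs.v *)
From HB Require Import structures.
From mathcomp Require Import all_boot all_order all_algebra.

Set Implicit Arguments.
Unset Strict Implicit.
Unset Printing Implicit Defensive.

Import GRing.Theory.
Local Open Scope ring_scope.

Fixpoint fibpoly (R : nzRingType) (n : nat) : {poly R} :=
  match n with
  | 0 => 0
  | 1 => 1
  | (m.+1 as n').+1 => 'X * fibpoly R n' + fibpoly R m
  end.

Lemma fibpolySS (R : nzRingType) (n : nat) :
  fibpoly R n.+2 = 'X * fibpoly R n.+1 + fibpoly R n.
Proof. by []. Qed.

(* The coefficient b_k of z^k in (z^(s+1) - z) / (z^(q-1) - 1).  The division
   is exact when q - 1 divides s: [bcoefP] is the defining identity, with
   s = m (q - 1), and [bcoefE] gives the explicit 0/1 value. *)
Definition bcoef (F : fieldType) (q s k : nat) : F :=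
  (('X^(s.+1) - 'X) %/ ('X^(q - 1) - 1) : {poly F})`_k.

Lemma bcoef_exact (F : fieldType) (q m : nat) :
  'X^(((q - 1) * m).+1) - 'X
   = (\sum_(t < m) 'X^(1 + t * (q - 1))) * ('X^(q - 1) - 1) :> {poly F}.
Proof.
have -> : 'X^(((q - 1) * m).+1) - 'X = 'X * ('X^((q - 1) * m) - 1) :> {poly F}.
  by rewrite mulrBr mulr1 -exprS.
rewrite exprM subrX1 [RHS]mulrC mulrCA; congr (_ * _).
rewrite mulr_sumr; apply: eq_bigr => t _.
by rewrite -exprM mulnC -exprS.
Qed.

Lemma bcoef_quo (F : fieldType) (q m : nat) : (1 < q)%N ->
  ('X^(((q - 1) * m).+1) - 'X) %/ ('X^(q - 1) - 1)
  = \sum_(t < m) 'X^(1 + t * (q - 1)) :> {poly F}.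
Proof.
move=> q_gt1; rewrite bcoef_exact mulpK //.
by rewrite -size_poly_gt0 size_XnsubC // subn_gt0.
Qed.

Lemma bcoefE (F : fieldType) (q m k : nat) : (1 < q)%N ->
  bcoef F q ((q - 1) * m) k
  = [exists t : 'I_m, k == (1 + t * (q - 1))%N]%:R.
Proof.
move=> q_gt1; rewrite /bcoef bcoef_quo // coef_sum.
under eq_bigr do rewrite coefXn.
case: existsP => [[t /eqP ->]|nex] /=.
  rewrite (bigD1 t) //= eqxx big1 ?addr0 // => u ne_ut.
  rewrite eqn_add2l eqn_pmul2r ?subn_gt0 //.
  by rewrite eq_sym (inj_eq val_inj) (negbTE ne_ut).
rewrite big1 // => t _; case: eqP => // ek.
by case: nex; exists t; apply/eqP.
Qed.

Lemma bcoefP (F : fieldType) (q s m : nat) :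
  (1 < q)%N -> (0 < m)%N -> s = ((q - 1) * m)%N ->
  (\sum_(1 <= k < (s - q + 2).+1) bcoef F q s k *: 'X^k) * ('X^(q - 1) - 1)
  = 'X^(s.+1) - 'X :> {poly F}.
Proof.
move=> q_gt1 m_gt0 ->; rewrite [RHS]bcoef_exact -bcoef_quo //; congr (_ * _).
have b0 : bcoef F q ((q - 1) * m) 0 = 0.
  by rewrite bcoefE //; case: existsP => // -[t]; rewrite add1n.
rewrite -[LHS]add0r -[X in X + _](scale0r 'X^0) -b0 -big_ltn //.
rewrite big_mkord -poly_def; apply/polyP => k; rewrite coef_poly.
case: ltnP => // le_k; rewrite -/(bcoef F q ((q - 1) * m) k) bcoefE //.
case: existsP => // -[t /eqP ek]; move: le_k; rewrite ek ltnNge => /negP[].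
rewrite add1n addn2 !ltnS.
have -> : ((q - 1) * m - q = ((q - 1) * m.-1).-1)%N.
  rewrite -[m in LHS](prednK m_gt0) mulnS.
  have {3}-> : q = (q - 1 + 1)%N by rewrite subnK // ltnW.
  by rewrite subnDA addKn subn1.
apply: leq_trans (leqSpred _).
by rewrite mulnC leq_mul2l -ltnS (prednK m_gt0) ltn_ord orbT.
Qed.

(* Main.v *)
(* For fixed x the series sum_j f_j(x) z^j is z / L_x with L_x = 1 - x z - z^2.
   As x^q = x, Frobenius gives
     D := (1 + z^(q+1)) (1 - z^(q-1)) = L_x (L_x^(q-1) - z^(q-1)),
   and the power sums over F_q give sum_x L_x^(q-1) = - z^(q-1), hence
     sum_x sum_j f_j(x) z^j = - z^q / D.
   Clearing only the factor 1 - z^(q-1), which divides 1 - z^s, yields the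
   recurrence with inhomogeneous term b.  As q = 1 mod 4, both factors of D
   divide 1 - z^((q^2-1)/2), so D divides its p-th power 1 - z^s; the series is
   then - z^q Q / (1 - z^s) with Q monic of degree s - 2q, which gives the values
   for j >= s - q.  Power series are truncated modulo z^(s+1). *)
Require Import Defs.
From HB Require Import structures.
From mathcomp Require Import all_boot all_order all_algebra finfield.
From mathcomp Require Import ring zify.

Set Implicit Arguments.
Unset Strict Implicit.
Unset Printing Implicit Defensive.

Import GRing.Theory.
Local Open Scope ring_scope.

(** The recurrence makes the product telescope; the last two terms are the boundary left by
    truncating the series. *)
Lemma fibpoly_gen (R : comNzRingType) (x : R) (n : nat) :
  (1 - x *: 'X - 'X^2) * \poly_(j < n.+1) (fibpoly R j).[x]
  = 'X - (fibpoly R n.+1).[x] *: 'X^(n.+1) - (fibpoly R n).[x] *: 'X^(n.+2).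
Proof.
rewrite poly_def; elim: n => [|n IHn].
  rewrite big_ord1 /=. rewrite !hornerE !scale0r scale1r; ring.
rewrite big_ord_recr /= mulrDr IHn hornerD hornerM hornerX.
rewrite -!mul_polyC !polyCD !polyCM !exprS; ring.
Qed.

(** * Power sums over a finite field *)

Lemma natr_card_finField (F : finFieldType) : #|F|%:R = 0 :> F.
Proof.
have : \sum_(x : F) (x + 1) = \sum_(x : F) x.
  by rewrite [RHS](reindex_inj (addIr 1)).
by rewrite big_split /= sumr_const => /(canRL (addKr _)) ->; rewrite addNr.
Qed.

(** Multiplication by a nonzero [g] permutes F and scales the sum by [g ^+ k]. For k > 0 some such
    [g] has [g ^+ k != 1], since X^k - 1 has at most k < q - 1 roots; for k = 0 the sum is q = 0 in
    F. *)
Lemma sum_expf_eq0 (F : finFieldType) (k : nat) :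
  (k < #|F| - 1)%N -> \sum_(x : F) x ^+ k = 0.
Proof.
case: k => [_|k lt_k].
  by under eq_bigr do rewrite expr0; rewrite sumr_const natr_card_finField.
have [g g_neq0 gk_neq1] : exists2 g : F, g != 0 & g ^+ k.+1 != 1.
  apply/exists_inP; apply: contraTT lt_k; rewrite negb_exists_in.
  move=> /forall_inP all1; rewrite -leqNgt.
  have: (size (enum (predC1 0%R : {pred F}))
         < size ('X^(k.+1) - 1 : {poly F})%R)%N.
    apply: max_poly_roots; last exact: enum_uniq.
      by rewrite -size_poly_gt0 size_XnsubC.
    apply/allP=> y; rewrite mem_enum => /all1/negPn/eqP y1.
    by rewrite rootE !hornerE y1 subrr.
  by rewrite size_XnsubC // ltnS -cardE cardC1 subn1.
apply/eqP; have /eqP : (g ^+ k.+1 - 1) * \sum_(x : F) x ^+ k.+1 = 0.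
  rewrite mulrBl mul1r mulr_sumr [X in _ - X](reindex_inj (mulfI g_neq0)) /=.
  by rewrite -sumrB big1 // => x _; rewrite exprMn subrr.
by rewrite mulf_eq0 subr_eq0 (negbTE gk_neq1).
Qed.

Lemma sum_expf_max (F : finFieldType) : \sum_(x : F) x ^+ (#|F| - 1) = -1.
Proof.
have q_gt1 := finNzRing_gt1 F.
rewrite (bigD1 0) //= expr0n subn_eq0 leqNgt q_gt1 add0r.
rewrite (eq_bigr (fun=> 1)) => [|x x0]; last first.
  by apply: (mulfI x0); rewrite -exprS mulr1 subn1 (ltn_predK q_gt1) expf_card.
rewrite sumr_const (cardC1 (0 : F)) -subn1.
by rewrite natrB ?natr_card_finField ?sub0r // ltnW.
Qed.

(** In the binomial expansion every power sum of exponent below q - 1 vanishes, so [a] drops out. *)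
Lemma sum_linear_exp (F : finFieldType) (a : {poly F}) :
  \sum_(x : F) (a - x *: 'X) ^+ (#|F| - 1) = - 'X^(#|F| - 1).
Proof.
set n := (#|F| - 1)%N.
under eq_bigr do rewrite -scaleNr exprDn.
rewrite (reindex_inj (@oppr_inj F)) /= exchange_big big_ord_recr /=.
rewrite big1 ?add0r => [|i _].
  rewrite -[RHS]scaleN1r -(sum_expf_max F) scaler_suml.
  apply: eq_bigr => x _.
  by rewrite subnn binn opprK expr0 mul1r mulr1n exprZn.
under eq_bigr do rewrite opprK exprZn -scalerAr scalerMnr.
by rewrite -scaler_suml sum_expf_eq0 ?scale0r.
Qed.

Lemma finField_pchar (F : finFieldType) (p e : nat) :
  prime p -> #|F| = (p ^ e)%N -> p \in [pchar F].
Proof.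
move=> p_pr cF; rewrite inE p_pr /=.
by have /eqP := natr_card_finField F; rewrite cF natrX expf_eq0 => /andP[].
Qed.

(** * The generating function summed over the field *)

Section PowerOfPrime.

Variables (p e : nat) (F : finFieldType).
Hypotheses (p_pr : prime p) (cF : #|F| = (p ^ e)%N).
Local Notation q := #|F|.
Local Notation L x := (1 - x *: 'X - 'X^2 : {poly F}).
Local Notation D := ((1 + 'X^(q + 1)) * (1 - 'X^(q - 1)) : {poly F}).

Lemma pnat_poly : [pchar {poly F}].-nat q.
Proof.
have p_char : p \in [pchar {poly F}].
  by rewrite pchar_poly (finField_pchar p_pr cF).
by rewrite (eq_pnat _ (pcharf_eq p_char)) cF pnatX pnat_id.
Qed.

(** The term x X^q of L_x^q cancels against the one from X^(q-1) L_x, so D is free of x: a common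
    denominator for all the series. *)
Lemma L_dvd_D (x : F) : L x * (L x ^+ (q - 1) - 'X^(q - 1)) = D.
Proof.
have q_gt0 : (0 < q)%N by rewrite ltnW // finNzRing_gt1.
have Lq : L x * L x ^+ (q - 1)
          = 1 - x *: ('X * 'X^(q - 1)) - ('X * 'X^(q-1))^+2.
  rewrite -!exprS subn1 prednK // !(exprDn_pchar _ _ pnat_poly).
  rewrite !(exprNn_pchar _ pnat_poly) expr1n exprZn expf_card.
  by rewrite -!exprM mulnC.
rewrite mulrBr Lq.
have -> : (q + 1 = 2 + (q - 1))%N by lia.
rewrite exprD -!mul_polyC; ring.
Qed.

Lemma sum_fibpoly_gen (n : nat) : exists R : {poly F},
  D * \poly_(j < n.+1) (\sum_(x : F) (fibpoly F j).[x])
  = - 'X^q + 'X^(n.+1) * R.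
Proof.
pose r x := L x ^+ (q - 1) - 'X^(q - 1).
(* [r x] is the cofactor D / L_x; the witness collects the boundary terms of [fibpoly_gen]. *)
exists (\sum_x r x * - ((fibpoly F n.+1).[x]%:P + (fibpoly F n).[x]%:P * 'X)).
have -> : \poly_(j < n.+1) (\sum_(x : F) (fibpoly F j).[x])
          = \sum_(x : F) \poly_(j < n.+1) (fibpoly F j).[x].
  rewrite poly_def (eq_bigr _ (fun i _ => scaler_suml _ _ _ _)) exchange_big.
  by apply: eq_bigr => x _; rewrite poly_def.
have -> : - 'X^q = \sum_x r x * 'X.
  rewrite -mulr_suml big_split /=.
  have -> : \sum_x L x ^+ (q - 1) = - 'X^(q - 1).
    rewrite -[RHS](sum_linear_exp (1 - 'X^2)).
    by apply: eq_bigr => x _; rewrite addrAC.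
  (* The summand - X^(q-1) is added q times, hence contributes 0. *)
  rewrite sumr_const -[_ *+ q]mulr_natr -polyC_natr.
  rewrite natr_card_finField mulr0 addr0.
  by rewrite mulNr -exprSr subn1 prednK // ltnW // finNzRing_gt1.
rewrite !mulr_sumr -big_split; apply: eq_bigr => x _ /=.
rewrite -(L_dvd_D x) mulrAC fibpoly_gen -/(r x) -!mul_polyC [in 'X^(n.+2)]exprS.
ring.
Qed.

End PowerOfPrime.

(** * Divisibility of X^s - 1 by the denominator *)

Lemma dvdp_sub1Xn (R : idomainType) (u : {poly R}) (n : nat) :
  u - 1 %| u ^+ n - 1.
Proof. by rewrite subrX1 dvdp_mulIl. Qed.

(** The two factors share the square roots of -1 as roots, so each is given its own copy of X^h - 1
    inside (X^h - 1)^p. Here h = (q^2 - 1)/2 is a multiple of both q - 1 and 2(q + 1). *)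
Lemma fibpoly_den_dvd (F : finFieldType) (p e : nat) :
  prime p -> #|F| = (p ^ e)%N -> (#|F| %% 4 = 1)%N ->
  (('X^(#|F| + 1) + 1) * ('X^(#|F| - 1) - 1) : {poly F})
    %| 'X^((p * (#|F| ^ 2 - 1)) %/ 2) - 1.
Proof.
move=> p_pr cF q4; set q := #|F| in q4 *.
have q_gt1 : (1 < q)%N by exact: finNzRing_gt1.
pose k := (q %/ 4)%N; have qE : q = (4 * k + 1)%N.
  by rewrite {1}(divn_eq q 4) q4 mulnC.
pose h := ((q - 1) * (2 * k + 1))%N.
have -> : ((p * (q ^ 2 - 1)) %/ 2 = h * p)%N.
  have -> : (p * (q ^ 2 - 1) = (h * p) * 2)%N.
    rewrite /h qE addnK expnS expn1.
    have -> : ((4 * k + 1) * (4 * k + 1) - 1 = 4 * k * (4 * k + 2))%N by nia.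
    by nia.
  by rewrite mulnK.
have p_char : p \in [pchar {poly F}].
  by rewrite pchar_poly (finField_pchar p_pr cF).
have pnat_p : [pchar {poly F}].-nat p.
  by rewrite (eq_pnat _ (pcharf_eq p_char)) pnat_id.
have -> : 'X^(h * p) - 1 = ('X^h - 1) ^+ p :> {poly F}.
  by rewrite exprM (exprDn_pchar _ _ pnat_p) (exprNn_pchar _ pnat_p) expr1n.
apply: dvdp_trans (dvdp_exp2l _ (prime_gt1 p_pr)); rewrite expr2.
apply: dvdp_mul; last by rewrite /h exprM dvdp_sub1Xn.
have -> : h = (((q + 1) * 2) * k)%N by rewrite /h qE; nia.
rewrite exprM; apply: dvdp_trans (dvdp_sub1Xn _ _).
by rewrite exprM -[X in _ %| _ - X](expr1n _ 2) subr_sqr dvdp_mulIr.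
Qed.

(** * Reading off coefficients modulo X^(s+1) *)

Section Truncation.

Variables (p e q : nat) (F : finFieldType).
Hypotheses (p_pr : prime p) (cF : #|F| = (p ^ e)%N) (Fq : #|F| = q).
Local Notation T s := (\poly_(j < s.+1) (\sum_(x : F) (fibpoly F j).[x])).

Lemma sum_fibpoly_X_dvd (s : nat) : exists T', T s = 'X * T'.
Proof.
exists (drop_poly 1 (T s)).
rewrite mulrC -[LHS](poly_take_drop 1) [take_poly _ _](_ : _ = 0) ?add0r //.
apply/polyP=> -[|i]; rewrite coef_take_poly coef0 //=.
by rewrite coef_poly /= big1 // => x _; rewrite hornerC.
Qed.

(** Serves the recurrence with A = 1 + X^(q+1) and the tail with A = 1. As f_0 = 0, X divides [T s],
    so the error A X^s [T s] only has terms of degree above s. *)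
Lemma coef_sum_fibpoly_gen (s j : nat) (A B : {poly F}) :
  (1 + 'X^(q + 1)) * (1 - 'X^(q - 1)) * B = A * (1 - 'X^s) -> (j <= s)%N ->
  (A * T s)`_j = - ('X^q * B)`_j.
Proof.
move=> EB le_js.
have [R] := sum_fibpoly_gen p_pr cF s; rewrite Fq => ER.
have [T' ET] := sum_fibpoly_X_dvd s.
have -> : A * T s = - ('X^q * B) + 'X^(s.+1) * (R * B + A * T').
  transitivity (A * (1 - 'X^s) * T s + A * 'X^s * T s); first by ring.
  rewrite -EB mulrAC ER {}ET exprS; ring.
by rewrite coefD coefXnM ltnS le_js addr0 coefN.
Qed.

Lemma sum_fibpoly_rec (s m j : nat) :
  s = ((q - 1) * m)%N -> (j <= s)%N ->
  \sum_(x : F) (fibpoly F j).[x]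
  = - bcoef F q s (j - (q - 1))
    - (if (j < q + 1)%N then 0 else \sum_(x : F) (fibpoly F (j - (q + 1))).[x]).
Proof.
move=> Es le_js; have q_gt1 : (1 < q)%N by rewrite -Fq finNzRing_gt1.
pose B : {poly F} := \sum_(t < m) 'X^(t * (q - 1)).
have EB : ('X^(s.+1) - 'X) %/ ('X^(q - 1) - 1) = 'X * B.
  by rewrite Es bcoef_quo // mulr_sumr; apply: eq_bigr => t _; rewrite -exprS.
have Bgeo : B * (1 - 'X^(q - 1)) = 1 - 'X^s.
  apply: (mulfI (negbT (polyX_eq0 F))).
  rewrite mulrA -EB -[1 - 'X^(q - 1)]opprB mulrN.
  rewrite Es bcoef_quo // -bcoef_exact exprS; ring.
have /coef_sum_fibpoly_gen/(_ le_js) :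
    (1 + 'X^(q + 1)) * (1 - 'X^(q - 1)) * B = (1 + 'X^(q + 1)) * (1 - 'X^s).
  by rewrite -Bgeo mulrAC mulrA.
have Xq : 'X^q = 'X^(q - 1) * 'X :> {poly F}.
  by rewrite -exprSr subn1 (ltn_predK q_gt1).
rewrite Xq -mulrA -EB mulrDl mul1r coefD !coefXnM !coef_poly !ltnS le_js.
rewrite (leq_trans (leq_subr _ _) le_js) => /(canRL (addrK _)) ->.
congr (- _ - _); case: ltnP => // lt_j.
(* Truncated subtraction gives index 0, where b vanishes because ['X * B] has no constant term. *)
have /eqP -> : (j - (q - 1) == 0)%N by rewrite subn_eq0 ltnW.
by rewrite /bcoef EB coefXM.
Qed.

Lemma sum_fibpoly_tail (s : nat) :
  ('X^(q + 1) + 1) * ('X^(q - 1) - 1) %| ('X^s - 1 : {poly F}) -> (0 < s)%N ->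
  \sum_(x : F) (fibpoly F (s - q)).[x] = -1 /\
  forall j, (s - q < j <= s)%N -> \sum_(x : F) (fibpoly F j).[x] = 0.
Proof.
move=> dvdD s_gt0; have q_gt1 : (1 < q)%N by rewrite -Fq finNzRing_gt1.
have [Q EQ] : exists Q : {poly F},
    'X^s - 1 = Q * (('X^(q + 1) + 1) * ('X^(q - 1) - 1)).
  exact/dvdpP.
have q1_gt0 : (0 < q - 1)%N by rewrite subn_gt0.
have mon1 : 'X^(q + 1) + 1 \is @monic F.
  by rewrite monicE lead_coefXnaddC ?addn1.
have mon2 : 'X^(q - 1) - 1 \is @monic F by rewrite monicXnsubC.
have monM : ('X^(q + 1) + 1) * ('X^(q - 1) - 1) \is @monic F by rewrite monicMl.
have monQ : Q \is monic by rewrite -(monicMr _ monM) -EQ monicXnsubC.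
(* That is, Q has degree s - 2q. *)
have sizeQ : (size Q + (q + q) = s.+1)%N.
  have := congr1 (fun r : {poly F} => size r) EQ.
  rewrite /= (size_Mmonic (monic_neq0 monQ) monM).
  rewrite (size_Mmonic (monic_neq0 mon1) mon2).
  rewrite size_XnaddC ?addn1 // !size_XnsubC // => ->.
  by move: (size Q) => n; clear -q_gt1; lia.
have Q_gt0 : (0 < size Q)%N by rewrite size_poly_gt0 monic_neq0.
have Sj j : (j <= s)%N ->
    \sum_(x : F) (fibpoly F j).[x] = - (if (j < q)%N then 0 else Q`_(j - q)).
  move=> le_js; have /coef_sum_fibpoly_gen/(_ le_js) :
      (1 + 'X^(q + 1)) * (1 - 'X^(q - 1)) * Q = 1 * (1 - 'X^s).
    transitivity (- (Q * (('X^(q + 1) + 1) * ('X^(q - 1) - 1)))); first by ring.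
    by rewrite -EQ opprB mul1r.
  by rewrite mul1r coef_poly ltnS le_js coefXnM.
split=> [|j /andP[lt_j le_j]]; rewrite Sj ?leq_subr //.
  have -> : (s - q < q)%N = false by lia.
  (* The index j = s - q meets exactly the leading coefficient of Q. *)
  have -> : (s - q - q = (size Q).-1)%N by lia.
  by rewrite -lead_coefE (monicP monQ).
have le_Qj : (size Q <= j - q)%N by lia.
by rewrite nth_default // if_same oppr0.
Qed.

End Truncation.

Theorem theorem5p4 (p e q s : nat) (F : finFieldType)
  (p_prime : prime p) (p_odd : odd p) (e_gt0 : (0 < e)%N)
  (hpe : (p %% 4 = 1)%N \/ (p %% 4 = 3)%N /\ ~~ odd e)
  (hq : q = (p ^ e)%N) (hF : #|F| = q)
  (hs : s = ((p * (q ^ 2 - 1)) %/ 2)%N)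
  (j : nat) :
  [/\ (1 <= j <= q - 1)%N -> \sum_(x : F) (fibpoly F j).[x] = 0,
      (q <= j <= q + 1)%N ->
        \sum_(x : F) (fibpoly F j).[x] = - bcoef F q s (j - (q - 1)),
      (q + 2 <= j <= s - (q + 1))%N ->
        \sum_(x : F) (fibpoly F j).[x] =
          - bcoef F q s (j - (q - 1))
          - \sum_(x : F) (fibpoly F (j - (q + 1))).[x],
      j = (s - q)%N ->
        \sum_(x : F) (fibpoly F j).[x] = - bcoef F q s (j + 2)
    & (s - (q - 1) <= j <= s)%N -> \sum_(x : F) (fibpoly F j).[x] = 0].
Proof.
have cF : #|F| = (p ^ e)%N by rewrite hF.
have q_gt1 : (1 < q)%N by rewrite -hF finNzRing_gt1.
(* For p = 3 mod 4, e is even and 3^2 = 1 mod 4. *)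
have q4 : (q %% 4 = 1)%N.
  rewrite hq -modnXm; case: hpe => [-> | [-> /even_halfK <-]].
    by rewrite exp1n.
  by rewrite -mul2n expnM -modnXm exp1n.
have p_gt1 := prime_gt1 p_prime.
(* Here k = (q + 1)/2, so that m = p(q + 1)/2 counts the nonzero b_k. *)
have [k qk] : exists k, (q + 1 = k * 2)%N by apply/dvdnP; lia.
pose m := (p * k)%N.
have le_m : (q + 1 <= m)%N by rewrite qk /m mulnC leq_mul2r p_gt1 orbT.
have Es : s = ((q - 1) * m)%N.
  rewrite hs -[(q ^ 2 - 1)%N]/(q ^ 2 - 1 ^ 2)%N subn_sqr qk /m.
  by rewrite mulnCA !mulnA mulnK.
have le_2q : (q + q <= s)%N.
  by rewrite Es; apply: leq_trans (leq_mul (_ : 2 <= q - 1)%N le_m); lia.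
have b0 : bcoef F q s 0 = 0.
  by rewrite Es bcoefE //; case: existsP => // -[t]; rewrite add1n.
have rec := sum_fibpoly_rec p_prime cF hF.
have [top tail] : \sum_(x : F) (fibpoly F (s - q)).[x] = -1 /\
    forall j, (s - q < j <= s)%N -> \sum_(x : F) (fibpoly F j).[x] = 0.
  have := fibpoly_den_dvd p_prime cF; rewrite hF -hs => /(_ q4) dvdD.
  have := sum_fibpoly_tail p_prime cF hF (s := s); apply => //; lia.
split=> [/andP[j1 jq]|/andP[j1 jq]|/andP[j1 jq]|->|/andP[j1 jq]].
- rewrite (rec _ _ _ Es); last by lia.
  have -> : (j < q + 1)%N by lia.
  by rewrite (eqP (_ : j - (q - 1) == 0)%N) ?subn_eq0 // b0 oppr0 addr0.
- rewrite (rec _ _ _ Es); last by lia.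
  case: ltnP => [_|lej]; first by rewrite subr0.
  (* At j = q + 1 the extra sum is that of f_0 = 0. *)
  rewrite (_ : (j - (q + 1) = 0)%N); last by lia.
  by rewrite big1 ?subr0 // => x _; rewrite hornerC.
- rewrite (rec _ _ _ Es); last by lia.
  by rewrite ltnNge (_ : (q + 1 <= j)%N) //; lia.
(* The index s - q + 2 is 1 + (m - 1)(q - 1), the last one with b = 1. *)
- rewrite top Es bcoefE //; congr (- _); case: existsP => // nex; case: nex.
  have lt_m : (m.-1 < m)%N by lia.
  have Es' : (s = q - 1 + m.-1 * (q - 1))%N.
    by rewrite -mulSn prednK ?(leq_ltn_trans _ lt_m) // mulnC.
  by exists (Ordinal lt_m); apply/eqP => /=; rewrite -Es; lia.
by apply: tail; lia.
Qed.
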